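(* Let $A\in\mathbb{R}^{m\times n}$ be a sub-Gaussian random matrix with variance proxy $\sigma^2>0$. Then for any $\delta\in(0,1)$ and any $\varepsilon\in(0,1)$, $$\mathbb{P}\left(\|A\|\le \sigma\sqrt{\frac{\log\frac{1}{1-\varepsilon^2}}{\varepsilon^4}(m+n)+\frac{2}{\varepsilon^4}\log\frac{1}{\delta}}\right)\ge 1-\delta,$$ where $\|A\|$ denotes the operator norm of $A$ (largest singular value).
   Context: A random matrix $A\in\mathbb{R}^{m\times n}$ is sub-Gaussian with variance proxy $\sigma^2$ if $\mathbb{E}[A]=0$ and $\mathbb{E}\left[e^{\lambda u^\top A v}\right]\le e^{\lambda^2\sigma^2/2}$ for all $\lambda\in\mathbb{R}$, all $u\in\mathcal{S}^{m-1}$ and all $v\in\mathcal{S}^{n-1}$, where $\mathcal{S}^{k-1}=\{x\in\mathbb{R}^k:\|x\|=1\}$ is the Euclidean unit sphere. No independence of the entries of $A$ is assumed. *)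

(* Defs.v *)
From HB Require Import structures.
From mathcomp Require Import all_boot all_order all_algebra.
From mathcomp Require Import all_classical all_reals all_analysis.
Set Implicit Arguments. Unset Strict Implicit. Unset Printing Implicit Defensive.
Import Order.TTheory GRing.Theory Num.Theory.
Local Open Scope ring_scope.
Local Open Scope classical_set_scope.

Definition vnorm (R : realType) (k : nat) (x : 'cV[R]_k) : R :=
  Num.sqrt (\sum_(i < k) x i 0 ^+ 2).

Definition sphere (R : realType) (k : nat) : set 'cV[R]_k :=
  [set x | vnorm x = 1].

Definition bilin (R : realType) (m n : nat) (u : 'cV[R]_m) (A : 'M[R]_(m, n))
  (v : 'cV[R]_n) : R := (u^T *m A *m v) 0 0.

Definition opnorm (R : realType) (m n : nat) (A : 'M[R]_(m, n)) : R :=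
  sup [set vnorm (A *m x) | x in @sphere R n].

Definition subgaussian_matrix (d : measure_display) (T : measurableType d)
  (R : realType) (P : probability T R) (m n : nat) (A : T -> 'M[R]_(m, n))
  (sigma : R) : Prop :=
  (forall i j, measurable_fun setT (fun w => A w i j)) /\
  (forall i j, P.-integrable setT (fun w => (A w i j)%:E)) /\
  (forall i j, ('E_P[fun w => A w i j] = 0)%E) /\
  (forall (lambda : R) (u : 'cV[R]_m) (v : 'cV[R]_n),
      u \in @sphere R m -> v \in @sphere R n ->
      ('E_P[fun w => expR (lambda * bilin u (A w) v)]
        <= (expR (lambda ^+ 2 * sigma ^+ 2 / 2))%:E)%E).

(* Main.v *)
(* The operator norm is controlled by averaging the sub-Gaussian bound over directions u, v
   uniform on the spheres. For v uniform on the sphere of R^n,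
     E exp(a.v) = sum_k |a|^(2k) / (4^k k! (n/2)_k),
   and Cauchy-Schwarz against the binomial series of (1 - e^2)^(-n/2) gives
     exp(e |a|) <= (1 - e^2)^(-n/2) E exp(a.v).
   Applying this with a = l A^T u and then with a = e l A w, w a maximising direction, gives
     E exp(e^2 l |A|) <= (1 - e^2)^(-(m+n)/2) exp(l^2 s^2 / 2),
   and Markov's inequality with l = e^2 t / s^2 concludes.

   No measure on the sphere is needed: the truncated series is reached by induction on n,
   writing a unit vector as (sin t, cos t * y'). Once truncated, everything is a
   trigonometric polynomial in t, and Rolle's theorem provides one angle t at which it
   takes its mean value. *)
Require Import Defs.
From HB Require Import structures.
From mathcomp Require Import all_boot all_order all_algebra.
From mathcomp Require Import all_classical all_reals all_analysis.
From mathcomp Require Import measurable_realfun ring lra zify.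
Import Order.TTheory GRing.Theory Num.Theory.
Import numFieldNormedType.Exports.
Local Open Scope ring_scope.
Local Open Scope classical_set_scope.

(** * Rising factorials and binomial series *)

(** Cauchy-Schwarz without square roots, by induction on [s]: the new cross term satisfies
    [2 c Z <= a Y + b X], because [4 (a b) (X Y) <= (a Y + b X)^2]. *)
Lemma sum_sqr_le_mul (R : realFieldType) (I : Type) (s : seq I) (x y z : I -> R) :
  (forall i, 0 <= x i) -> (forall i, 0 <= y i) ->
  (forall i, z i ^+ 2 <= x i * y i) ->
  (\sum_(i <- s) z i) ^+ 2 <= (\sum_(i <- s) x i) * (\sum_(i <- s) y i).
Proof.
move=> x0 y0 zxy.
suff [] : [/\ 0 <= \sum_(i <- s) x i, 0 <= \sum_(i <- s) y i &
   (\sum_(i <- s) z i) ^+ 2 <= (\sum_(i <- s) x i) * (\sum_(i <- s) y i)] by [].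
elim: s => [|i s [X0 Y0 IH]]; first by rewrite !big_nil expr0n mulr0.
rewrite !big_cons; set X := \sum_(i <- _) x i in X0 IH *.
set Y := \sum_(i <- _) y i in Y0 IH *; set Z := \sum_(i <- _) z i in IH *.
have := x0 i; have := y0 i; have := zxy i.
move: (x i) (y i) (z i) => a b c cab b0 a0.
split; [exact: addr_ge0|exact: addr_ge0|].
have cZ : c * Z *+ 2 <= a * Y + b * X.
  apply: le_trans (ler_norm _) _.
  rewrite -ler_sqr ?nnegrE ?addr_ge0 ?mulr_ge0 // -normrX ger0_norm ?sqr_ge0 //.
  have h : c ^+ 2 * Z ^+ 2 <= (a * b) * (X * Y) by apply: ler_pM; rewrite ?sqr_ge0.
  have := sqr_ge0 (a * Y - b * X); nra.
nra.
Qed.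

(** Pochhammer symbol: [rfact a k / k!] is the coefficient of [x^k] in [(1 - x)^(-a)]. *)
Definition rfact {R : realFieldType} (a : R) (k : nat) : R :=
  \prod_(i < k) (a + i%:R).

Lemma rfact0 (R : realFieldType) (a : R) : rfact a 0 = 1.
Proof. by rewrite /rfact big_ord0. Qed.

Lemma rfactS (R : realFieldType) (a : R) k : rfact a k.+1 = rfact a k * (a + k%:R).
Proof. by rewrite /rfact big_ord_recr. Qed.

Lemma rfact_gt0 (R : realFieldType) (a : R) k : 0 < a -> 0 < rfact a k.
Proof.
by move=> a0; apply: prodr_gt0 => i _; rewrite ltr_wpDr ?ler0n.
Qed.

Lemma sum_triangle (R : nmodType) (F : nat -> nat -> R) N :
  \sum_(0 <= k < N) \sum_(0 <= j < k.+1) F j (k - j)%N =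
  \sum_(0 <= j < N) \sum_(0 <= i < N - j) F j i.
Proof.
elim: N => [|N IH]; first by rewrite !big_geq.
rewrite big_nat_recr //= IH.
transitivity (\sum_(0 <= j < N.+1) (\sum_(0 <= i < N - j) F j i + F j (N - j)%N)).
  by rewrite big_split /= [in RHS]big_nat_recr //= subnn [X in _ + X + _]big_geq ?addr0.
apply: eq_big_nat => j /andP[_ jN].
by rewrite subSn // big_nat_recr.
Qed.

(** Coefficient comparison in [(1 - x)^(-a) (1 - x)^(-b) = (1 - x)^(-(a + b))]. The induction
    multiplies by [k + 1 = j + (k + 1 - j)] and applies [rec] to each factor. *)
Lemma vandermonde_rfact (R : realFieldType) (a b : R) k :
  \sum_(0 <= j < k.+1) rfact a j / j`!%:R * (rfact b (k - j) / (k - j)`!%:R) =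
  rfact (a + b) k / k`!%:R.
Proof.
have rec c i : (i.+1%:R) * (rfact c i.+1 / i.+1`!%:R) =
    (c + i%:R) * (rfact c i / i`!%:R) :> R.
  have d0 : i.+1%:R != 0 :> R by rewrite pnatr_eq0.
  have e0 : i`!%:R != 0 :> R by rewrite pnatr_eq0 -lt0n fact_gt0.
  rewrite rfactS factS natrM; move: (i.+1%:R) d0 => D d0.
  by field; rewrite d0 e0.
elim: k => [|k IH].
  by rewrite big_nat1 subnn !rfact0 divr1 mulr1.
have k0 : k.+1%:R != 0 :> R by rewrite pnatr_eq0.
apply: (mulfI k0); rewrite rec -IH !mulr_sumr.
transitivity (\sum_(0 <= j < k.+2) (j%:R * (rfact a j / j`!%:R)) * (rfact b (k.+1 - j) / (k.+1 - j)`!%:R)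
  + \sum_(0 <= j < k.+2) (rfact a j / j`!%:R) *
      ((k.+1 - j)%:R * (rfact b (k.+1 - j) / (k.+1 - j)`!%:R))).
  rewrite -big_split; apply: eq_big_nat => j /andP[_ jk].
  rewrite natrB //=; ring.
rewrite big_nat_recl // mul0r mul0r add0r [X in _ + X]big_nat_recr //= subnn mul0r mulr0 addr0.
rewrite -big_split; apply: eq_big_nat => j /andP[_ jk] /=.
rewrite rec subSS subSn // rec natrB //; ring.
Qed.

(** The square runs over [j, i < N], a part of the triangle [j + i < N + N] covered by the Cauchy
    product; all terms are nonnegative. *)
Lemma sqr_sum_rfact_le (R : realFieldType) (a x : R) N : 0 < a -> 0 <= x ->
  (\sum_(0 <= k < N) rfact a k / k`!%:R * x ^+ k) ^+ 2 <=
  \sum_(0 <= k < N + N) rfact (a + a) k / k`!%:R * x ^+ k.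
Proof.
move=> a0 x0.
have c0 k : 0 <= rfact a k / k`!%:R * x ^+ k.
  by rewrite mulr_ge0 ?exprn_ge0 // divr_ge0 // ltW // rfact_gt0.
pose F j i := (rfact a j / j`!%:R * x ^+ j) * (rfact a i / i`!%:R * x ^+ i).
have -> : \sum_(0 <= k < N + N) rfact (a + a) k / k`!%:R * x ^+ k =
   \sum_(0 <= k < N + N) \sum_(0 <= j < k.+1) F j (k - j)%N.
  apply: eq_bigr => k _; rewrite -vandermonde_rfact mulr_suml.
  apply: eq_big_nat => j /andP[_ jk].
  by rewrite /F -[in LHS](subnKC (_ : j <= k)%N) // exprD addKn; ring.
rewrite sum_triangle expr2 big_distrl /= [leRHS](big_cat_nat _ (n := N)) ?leq_addr //=.
rewrite -[leLHS]addr0 lerD //; last first.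
  by apply: sumr_ge0 => j _; apply: sumr_ge0 => i _; rewrite mulr_ge0.
rewrite [leLHS]big_nat [leRHS]big_nat; apply: ler_sum => j /andP[_ jN].
rewrite big_distrr /= [leRHS](big_cat_nat _ (n := N) (p := (N + N - j)%N)) //=; last first.
  by rewrite -addnBA ?leq_addr // ltnW.
by rewrite lerDl; apply: sumr_ge0 => i _; rewrite mulr_ge0.
Qed.

(** Multiplying by [1 - x] lowers the parameter by one. Truncation leaves a single boundary term,
    whose sign lets the next bound drop it for nonnegative [x]. *)
Lemma sum_rfact_pascal (R : realFieldType) (a x : R) N :
  (\sum_(0 <= k < N.+1) rfact (a + 1) k / k`!%:R * x ^+ k) * (1 - x) =
  \sum_(0 <= k < N.+1) rfact a k / k`!%:R * x ^+ k
    - rfact (a + 1) N / N`!%:R * x ^+ N.+1.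
Proof.
elim: N => [|N IH]; first by rewrite !big_nat1 !rfact0 /=; field.
rewrite big_nat_recr //= mulrDl IH [in RHS]big_nat_recr //=.
have -> : rfact a N.+1 = a * rfact (a + 1) N.
  rewrite /rfact big_ord_recl addr0; congr (_ * _).
  by apply: eq_bigr => i _; rewrite lift0 -nat1r addrA.
have d0 : N.+1%:R != 0 :> R by rewrite pnatr_eq0.
have e0 : N`!%:R != 0 :> R by rewrite pnatr_eq0 -lt0n fact_gt0.
rewrite rfactS factS natrM !exprS.
have -> : a + 1 + N%:R = a + N.+1%:R by rewrite -natr1; ring.
move: (N.+1%:R) d0 (rfact (_ + 1) N) => D d0 r.
by field; rewrite d0 e0.
Qed.

Lemma sum_rfact_nat_le (R : realFieldType) (x : R) n N : 0 <= x < 1 ->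
  \sum_(0 <= k < N) rfact n%:R k / k`!%:R * x ^+ k <= ((1 - x) ^+ n)^-1.
Proof.
move=> /andP[x0 x1]; have x1' : 0 < 1 - x by rewrite subr_gt0.
case: N => [|N]; first by rewrite big_geq // invr_ge0 exprn_ge0 // ltW.
elim: n => [|n IH].
  rewrite expr0 invr1 big_nat_recl // rfact0 divr1 mulr1 big1 ?addr0 // => k _.
  by rewrite /rfact big_ord_recl addr0 !mul0r.
rewrite exprS invfM ler_pdivlMl //.
apply: le_trans IH; rewrite mulrC -[n.+1%:R]natr1 sum_rfact_pascal gerBl.
by rewrite mulr_ge0 ?exprn_ge0 // divr_ge0 // ltW // rfact_gt0 // natr1 ltr0n.
Qed.

(* The left-hand side is a Taylor partial sum of [(1 - x) `^ (- n / 2)]; its square is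
   dominated by a partial sum for the integer exponent [n], where Pascal's rule applies. *)
Lemma sum_rfact_half_le (R : rcfType) (x : R) n N : (0 < n)%N -> 0 <= x < 1 ->
  \sum_(0 <= k < N) rfact (n%:R / 2) k / k`!%:R * x ^+ k <= Num.sqrt (((1 - x) ^+ n)^-1).
Proof.
move=> n0 x01; have /andP[x0 x1] := x01.
have n20 : 0 < n%:R / 2 :> R by rewrite divr_gt0 ?ltr0n.
rewrite -[leLHS]ger0_norm; last first.
  by apply: sumr_ge0 => k _; rewrite mulr_ge0 ?exprn_ge0 // divr_ge0 // ltW // rfact_gt0.
rewrite -sqrtr_sqr ler_wsqrtr //.
apply: le_trans (sqr_sum_rfact_le _ _ _ _ n20 x0) _.
by rewrite -splitr sum_rfact_nat_le.
Qed.

(** * Mean values of trigonometric polynomials *)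

(* [f] integrates to [0] over [- pi / 2, pi / 2], expressed through an antiderivative so
   that no integration theory is involved. *)
Definition zero_mean {R : realType} (f : R -> R) : Prop :=
  exists2 F : R -> R, (forall x : R, is_derive x 1 F (f x)) & F (- (pi / 2)) = F (pi / 2).

Lemma zero_meanD (R : realType) (f g : R -> R) :
  zero_mean f -> zero_mean g -> zero_mean (fun x => f x + g x).
Proof.
move=> [F dF eF] [G dG eG]; exists (F \+ G) => [x|/=]; last by rewrite eF eG.
exact: is_deriveD.
Qed.

Lemma zero_meanZ (R : realType) (f : R -> R) a :
  zero_mean f -> zero_mean (fun x => a * f x).
Proof.
move=> [F dF eF]; exists (a \*: F) => [x|/=]; last by rewrite eF.
exact: is_deriveZ.
Qed.

Lemma zero_mean_ext (R : realType) (f g : R -> R) :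
  f =1 g -> zero_mean f -> zero_mean g.
Proof. by move=> /funext ->. Qed.

Lemma zero_mean_sum (R : realType) (I : Type) (s : seq I) (f : I -> R -> R) :
  (forall i, zero_mean (f i)) -> zero_mean (fun x => \sum_(i <- s) f i x).
Proof.
move=> h; elim: s => [|i s IH].
  apply: (@zero_mean_ext _ (fun=> 0)) => [x|]; first by rewrite big_nil.
  by exists (cst 0) => // x; exact: is_derive_cst.
by apply: zero_mean_ext (zero_meanD _ _ _ (h i) IH) => x; rewrite big_cons.
Qed.

(* Antiderivative: [sin ^+ a.+1 * cos ^+ b.+1], which vanishes at both ends. *)
Lemma zero_mean_sin_cos (R : realType) (a b : nat) :
  zero_mean (fun x : R => (a + b).+2%:R * (sin x ^+ a * cos x ^+ b.+2) -
                          b.+1%:R * (sin x ^+ a * cos x ^+ b)).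
Proof.
exists ((@sin R) ^+ a.+1 * (@cos R) ^+ b.+1) => [x|]; last first.
  by rewrite !fctE /= !cosN cos_pihalf expr0n !mulr0.
have dS := is_deriveX a.+1 (is_derive_sin x).
have dC := is_deriveX b.+1 (is_derive_cos x).
have := is_deriveM dS dC; congr (is_derive _ _ _ _).
rewrite /GRing.scale /= !fctE /=.
have := cos2Dsin2 x; move: (sin x) (cos x) => s c h.
have -> : c ^+ b.+2 = c ^+ b * c ^+ 2 by rewrite -exprD addn2.
rewrite !exprS.
have -> : (a + b).+2%:R = a.+1%:R + b.+1%:R :> R by rewrite -natrD; congr (_%:R); lia.
have -> : s * s ^+ a * (b.+1%:R * c ^+ b * - s) = - b.+1%:R * s ^+ a * c ^+ b * (s ^+ 2) by ring.
have -> : s ^+ 2 = 1 - c ^+ 2 by rewrite -h; ring.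
ring.
Qed.

(* Mean of [sin ^+ j.*2 * cos ^+ i.*2] for the density proportional to [cos ^+ p]
   on [- pi / 2, pi / 2]. *)
Definition beta_moment {R : realType} (p j i : nat) : R :=
  rfact (1 / 2) j * rfact (p.+1%:R / 2) i / rfact (p.+2%:R / 2) (j + i).

(** The ratio is the one given by the integration by parts in [zero_mean_sin_cos], with [a = j.*2]
    and [b = p + i.*2]. *)
Lemma beta_moment_Sr (R : realType) (p j i : nat) :
  beta_moment p j i.+1 =
  (p + i.*2).+1%:R / (j.*2 + (p + i.*2)).+2%:R * beta_moment p j i :> R.
Proof.
rewrite /beta_moment addnS !rfactS.
have -> : (p + i.*2).+1%:R = 2 * (p.+1%:R / 2 + i%:R) :> R.
  by rewrite -addSn -muln2 natrD natrM; field.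
have -> : (j.*2 + (p + i.*2)).+2%:R = 2 * (p.+2%:R / 2 + (j + i)%:R) :> R.
  rewrite (_ : (_ + _).+2 = p.+2 + (j + i) * 2)%N; last by lia.
  by rewrite natrD natrM; field.
have p0 : 0 < p.+2%:R / 2 :> R by rewrite divr_gt0.
have r0 := rfact_gt0 _ _ (j + i) p0.
have s0 : 0 < p.+2%:R / 2 + (j + i)%:R :> R by rewrite ltr_wpDr.
by field; rewrite !gt_eqF.
Qed.

(** Counterpart for the moments of [sin^2 = 1 - cos^2]. *)
Lemma beta_moment_Sl (R : realType) (p j i : nat) :
  beta_moment p j.+1 i = beta_moment p j i - beta_moment p j i.+1 :> R.
Proof.
rewrite /beta_moment addnS addSn !rfactS natrD.
have p0 : 0 < p.+2%:R / 2 :> R by rewrite divr_gt0.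
have r0 := rfact_gt0 _ _ (j + i) p0.
have s0 : 0 < p.+2%:R / 2 + (j%:R + i%:R) :> R by rewrite ltr_wpDr // addr_ge0.
have E : p.+1%:R / 2 = p.+2%:R / 2 - 1 / 2 :> R by rewrite -[p.+2%:R]natr1; field.
move: p0 r0 s0 (rfact (p.+1%:R / 2) i) => p0 r0 s0 t; rewrite E.
move: (p.+2%:R / 2) p0 r0 s0 => P p0 r0 s0.
by field; rewrite !gt_eqF.
Qed.

(** At [j = 0], induction on [i] by the reduction formula [E], which raises the power of [cos] by
    two; then induction on [j], trading [sin^2] for [1 - cos^2]. *)
Lemma zero_mean_beta (R : realType) (p j i : nat) :
  zero_mean (fun x : R => sin x ^+ (j.*2) * cos x ^+ (p + i.*2) -
      beta_moment p j i * cos x ^+ p).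
Proof.
have E (a b : nat) (k : R) : zero_mean (fun x => sin x ^+ a * cos x ^+ b - k * cos x ^+ p) ->
   zero_mean (fun x => sin x ^+ a * cos x ^+ b.+2 - (b.+1%:R / (a + b).+2%:R) * k * cos x ^+ p).
  move=> h; have := zero_meanD _ _ _ (zero_meanZ _ _ (a + b).+2%:R^-1 (zero_mean_sin_cos R a b))
    (zero_meanZ _ _ (b.+1%:R / (a + b).+2%:R) h).
  apply: zero_mean_ext => x.
  have : (a + b).+2%:R != 0 :> R by rewrite pnatr_eq0; lia.
  by move: (a + b).+2%:R => D D0; field.
elim: j i => [|j IHj].
  elim=> [|i IH].
    exists (cst 0) => // x; rewrite addn0 expr0 mul1r /beta_moment !rfact0 divr1 !mul1r subrr.
    exact: is_derive_cst.
  rewrite beta_moment_Sr doubleS !addnS. exact: (E _ _ _ IH).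
move=> i; have := zero_meanD _ _ _ (IHj i) (zero_meanZ _ _ (-1) (IHj i.+1)).
apply: zero_mean_ext => x; rewrite beta_moment_Sl !doubleS !addnS !exprS.
have := cos2Dsin2 x; move: (sin x) (cos x) => t c h.
have {h} -> : c * (c * c ^+ (p + i.*2)) = (1 - t ^+ 2) * c ^+ (p + i.*2) by rewrite -h; ring.
ring.
Qed.

(* Mean value theorem for that density: a single angle realises the mean of a given
   linear combination of the monomials. *)
Lemma beta_mean_value (R : realType) (p : nat) (I : Type) (s : seq I) (u : I -> R) (j i : I -> nat) :
  exists t : R, \sum_(k <- s) u k * (sin t ^+ ((j k).*2) * cos t ^+ ((i k).*2)) =
    \sum_(k <- s) u k * beta_moment p (j k) (i k).
Proof.
have [F dF eF] := zero_mean_sum _ _ s _ (fun k => zero_meanZ _ _ (u k) (zero_mean_beta R p (j k) (i k))).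
have ltpi : - (pi / 2) < pi / 2 :> R by have := pi_gt0 R; lra.
have [||t tab dt] := Rolle ltpi _ _ eF.
- by move=> x _; exact: ex_derive.
- by apply: derivable_within_continuous => x _; exact: ex_derive.
(* The point given by Rolle is interior, so the weight [cos t ^+ p] is nonzero and can be divided
   out. *)
have /(cos_gt0_pihalf) c0 : - (pi / 2) < t < pi / 2 by move: tab; rewrite in_itv.
exists t; apply/eqP; rewrite -subr_eq0.
have := @derive_val _ _ _ _ _ _ _ dt; rewrite (@derive_val _ _ _ _ _ _ _ (dF t)) => h.
have cp : cos t ^+ p != 0 by rewrite expf_neq0 ?gt_eqF.
apply/eqP/(mulIf cp); rewrite mul0r -[RHS]h -sumrB mulr_suml.
apply: eq_bigr => k _; rewrite exprD; ring.
Qed.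

(** * The exponential series of the uniform law on the sphere *)

Lemma sum_triangle_le_square (R : numDomainType) (F : nat -> nat -> R) N :
  (forall j i, 0 <= F j i) ->
  \sum_(0 <= k < N) \sum_(0 <= j < k.+1) F j (k - j)%N <=
  \sum_(0 <= j < N) \sum_(0 <= i < N) F j i.
Proof.
move=> F0; rewrite sum_triangle; apply: ler_sum => j _.
rewrite [leRHS](big_cat_nat _ (n := (N - j)%N)) ?leq_subr //=.
by rewrite lerDl sumr_ge0.
Qed.

Lemma exprDn_fact (R : numFieldType) (x y : R) k :
  (x + y) ^+ k / k`!%:R =
  \sum_(0 <= j < k.+1) (x ^+ j / j`!%:R) * (y ^+ (k - j) / (k - j)`!%:R).
Proof.
rewrite addrC exprDn mulr_suml big_mkord; apply: eq_bigr => j _.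
have jk : (j <= k)%N by rewrite -ltnS.
have f0 m : m`!%:R != 0 :> R by rewrite pnatr_eq0 -lt0n fact_gt0.
rewrite -(bin_fact jk) !natrM -mulr_natr.
have : 'C(k, j)%:R != 0 :> R by rewrite pnatr_eq0 -lt0n bin_gt0.
by have := f0 j; have := f0 (k - j)%N; move=> ? ? ?; field; apply/and3P.
Qed.

(** Separates the even and odd factors of [(2j)!]. It makes [sphere_mgf 1] the truncated series of
    cosh, the mean over the two points of the sphere of R^1. *)
Lemma fact_double (R : realFieldType) j :
  (j.*2)`!%:R = 4 ^+ j * j`!%:R * rfact (1 / 2) j :> R.
Proof.
elim: j => [|j IH]; first by rewrite expr0 rfact0 !mulr1.
rewrite doubleS !factS !natrM IH rfactS exprS.
have -> : j.*2.+2%:R = 2 * j%:R + 2 :> R by rewrite -muln2 -addn2 natrD natrM; ring.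
have -> : j.*2.+1%:R = 2 * j%:R + 1 :> R by rewrite -muln2 -addn1 natrD natrM; ring.
by rewrite -natr1; field.
Qed.

(** In the series of [expR x + expR (- x)] odd terms cancel and even ones are nonnegative, so the
    partial sums increase to the limit. *)
Lemma sum_even_le_cosh (R : realType) (x : R) N :
  (\sum_(0 <= j < N) x ^+ j.*2 / (j.*2)`!%:R) * 2 <= expR x + expR (- x).
Proof.
pose u M : R := series (exp_coeff x) M + series (exp_coeff (- x)) M.
have uS M : u M.+1 = u M + (x ^+ M + (- x) ^+ M) / M`!%:R.
  by rewrite /u /series /exp_coeff /= !big_nat_recr //= mulrDl addrACA.
have -> : (\sum_(0 <= j < N) x ^+ j.*2 / (j.*2)`!%:R) * 2 = u (N.*2).
  elim: N => [|N IH]; first by rewrite /u /series /= !big_geq // mul0r addr0.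
  rewrite big_nat_recr //= mulrDl IH doubleS (uS N.*2.+1) (uS N.*2) !(exprNn x).
  rewrite -[(-1) ^+ N.*2]signr_odd -[(-1) ^+ N.*2.+1]signr_odd /= odd_double /=.
  by rewrite expr0 expr1; ring.
have cu : u @ \oo --> expR x + expR (- x).
  by apply: cvgD; exact: is_cvg_series_exp_coeff.
rewrite -(cvg_lim _ cu) //; apply: nondecreasing_cvgn_le; last first.
  by apply/cvg_ex; exists (expR x + expR (- x)).
apply/nondecreasing_seqP => M; rewrite uS lerDl divr_ge0 //.
rewrite exprNn -signr_odd; case: (boolP (odd M)) => oM.
  by rewrite expr1 mulN1r subrr.
by rewrite expr0 mul1r addr_ge0 // exprn_even_ge0.
Qed.

(* The first [N] even-order terms of [E (expR (a . y))], for [y] uniform on the unit sphere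
   of R^n and [Q] the squared norm of [a]. Meaningful for [0 < n] only. *)
Definition sphere_mgf {R : realFieldType} (n N : nat) (Q : R) : R :=
  \sum_(0 <= k < N) Q ^+ k / (4 ^+ k * k`!%:R * rfact (n%:R / 2) k).

Lemma sphere_mgf_ge0 (R : realFieldType) n N (Q : R) : 0 <= Q -> 0 <= sphere_mgf n.+1 N Q.
Proof.
move=> Q0; apply: sumr_ge0 => k _; rewrite divr_ge0 ?exprn_ge0 //.
by rewrite !mulr_ge0 ?exprn_ge0 // ltW // rfact_gt0 // divr_gt0.
Qed.

(* Slicing the unit sphere of R^(p+2) as [y = (sin t, cos t * y')], the angle [t] has
   density proportional to [cos ^+ p]. *)
Lemma sphere_mgfS_le (R : realType) p N (x Q : R) : 0 <= x -> 0 <= Q ->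
  sphere_mgf p.+2 N (x + Q) <= \sum_(0 <= j < N) \sum_(0 <= i < N)
    beta_moment p j i * (x ^+ j / (j.*2)`!%:R * (Q ^+ i / (4 ^+ i * i`!%:R * rfact (p.+1%:R / 2) i))).
Proof.
move=> x0 Q0.
have r0 q k : 0 < rfact (q.+1%:R / 2) k :> R by rewrite rfact_gt0 // divr_gt0.
have h0 k : 0 < rfact (1 / 2) k :> R by exact: (r0 0%N).
have f0 k : 0 < k`!%:R :> R by rewrite ltr0n fact_gt0.
have p0 k : 0 < 4 ^+ k :> R by rewrite exprn_gt0.
(* The two sides agree on the triangle [j + i < N]. The square only adds nonnegative terms, and it
   is the shape produced by a product of two truncated series. *)
apply: le_trans (sum_triangle_le_square _ _ _ _) => [|j i]; last first.
  have r1 q k := ltW (r0 q k); have h1 k := ltW (h0 k); have f1 k := ltW (f0 k).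
  by rewrite /beta_moment !(mulr_ge0, invr_ge0, exprn_ge0).
apply: ler_sum_nat => k _.
rewrite (_ : _ / _ = (x + Q) ^+ k / k`!%:R / (4 ^+ k * rfact (p.+2%:R / 2) k)); last first.
  by field; rewrite !gt_eqF.
rewrite exprDn_fact mulr_suml le_eqVlt; apply/orP; left; apply/eqP; apply: eq_big_nat => j /andP[_ jk].
rewrite /beta_moment subnKC // -[in LHS](subnKC (_ : j <= k)%N) // exprD addKn fact_double.
rewrite subnKC //.
by field; rewrite !gt_eqF.
Qed.

(** * Averaging exponential integrals over directions *)

Lemma integral_mono_ge0 d (T : measurableType d) (R : realType)
    (mu : {measure set T -> \bar R}) (f g : T -> R) :
  measurable_fun setT f -> measurable_fun setT g ->
  (forall w, 0 <= f w) -> (forall w, f w <= g w) ->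
  (\int[mu]_w (f w)%:E <= \int[mu]_w (g w)%:E)%E.
Proof.
move=> mf mg f0 fg; apply: ge0_le_integral => //.
- by move=> w _; rewrite lee_fin.
- exact/measurable_EFinP.
- exact/measurable_EFinP.
- by move=> w _; rewrite lee_fin.
Qed.

Lemma integral_lincomb_ge0 d (T : measurableType d) (R : realType)
    (mu : {measure set T -> \bar R}) (I : Type) (s : seq I)
    (u : I -> T -> R) (t : I -> R) :
  (forall k, measurable_fun setT (u k)) -> (forall k w, 0 <= u k w) -> (forall k, 0 <= t k) ->
  (\int[mu]_w (\sum_(k <- s) t k * u k w)%:E =
   \sum_(k <- s) (t k)%:E * \int[mu]_w (u k w)%:E)%E.
Proof.
move=> mu_ u0 t0.
under eq_integral do rewrite -sumEFin.
rewrite ge0_integral_sum //; first last.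
- by move=> k w _; rewrite lee_fin mulr_ge0.
- by move=> k; apply/measurable_EFinP; exact: measurable_funM.
apply: eq_bigr => k _; under eq_integral do rewrite EFinM.
rewrite ge0_integralZl_EFin //.
- by move=> w _; rewrite lee_fin.
- exact/measurable_EFinP.
Qed.

Lemma integral_le_average d (T : measurableType d) (R : realType)
    (mu : {measure set T -> \bar R}) (a b f : T -> R) (K : R) :
  measurable_fun setT a -> measurable_fun setT b -> measurable_fun setT f ->
  (forall w, 0 <= a w) -> (forall w, 0 <= b w) -> (forall w, 0 <= f w) ->
  (forall w, f w * 2 <= a w + b w) ->
  (\int[mu]_w (a w)%:E <= K%:E)%E -> (\int[mu]_w (b w)%:E <= K%:E)%E ->
  (\int[mu]_w (f w)%:E <= K%:E)%E.
Proof.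
move=> ma mb mf a0 b0 f0 fab aK bK.
pose u (k : bool) := if k then a else b.
have mu_ k : measurable_fun setT (u k) by case: k.
have u0 k w : 0 <= u k w by case: k.
apply: (@le_trans _ _ (\int[mu]_w (\sum_(k <- [:: true; false]) 2^-1 * u k w)%:E)%E).
  apply: integral_mono_ge0 => //.
    by apply: measurable_sum => k; exact: measurable_funM.
  by move=> w; rewrite !big_cons big_nil addr0 -mulrDr mulrC ler_pdivlMr.
rewrite integral_lincomb_ge0 // !big_cons big_nil adde0 /=.
apply: (@le_trans _ _ (2^-1%:E * K%:E + 2^-1%:E * K%:E)%E).
  by apply: leeD; apply: lee_wpmul2l; rewrite ?lee_fin ?invr_ge0.
by rewrite -!EFinM -EFinD lee_fin; lra.
Qed.

Lemma measurable_sphere_mgf d (T : measurableType d) (R : realType) n N (f : T -> R) :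
  measurable_fun setT f -> measurable_fun setT (fun w => sphere_mgf n N (f w)).
Proof.
move=> mf; apply: measurable_sum => k; apply: measurable_funM => //.
exact: measurable_funX.
Qed.

(** Averaging the hypothesis over [s] and [- s] turns the exponential into a cosh, which dominates
    its truncation. What remains is a polynomial in [s ^+ 2] and [c ^+ 2] bounded by [K] at every
    angle, hence at the angle where it equals its mean; by [sphere_mgfS_le] that mean dominates the
    integral in dimension [p.+2]. *)
Lemma sphere_average_step d (T : measurableType d) (R : realType)
    (mu : {measure set T -> \bar R}) (p N : nat) (g z Q : T -> R) (K : R) :
  measurable_fun setT g -> measurable_fun setT z -> measurable_fun setT Q ->
  (forall w, 0 <= g w) -> (forall w, 0 <= Q w) ->
  (forall s c : R, s ^+ 2 + c ^+ 2 = 1 ->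
    (\int[mu]_w (g w * expR (s * z w) * sphere_mgf p.+1 N (c ^+ 2 * Q w))%:E <= K%:E)%E) ->
  (\int[mu]_w (g w * sphere_mgf p.+2 N (z w ^+ 2 + Q w))%:E <= K%:E)%E.
Proof.
move=> mg mz mQ g0 Q0 hK.
have r0 q k : 0 <= rfact (q.+1%:R / 2) k :> R by rewrite ltW // rfact_gt0 // divr_gt0.
pose D i : R := 4 ^+ i * i`!%:R * rfact (p.+1%:R / 2) i.
have D0 i : 0 <= D i by rewrite /D !mulr_ge0 ?exprn_ge0 // r0.
have t0 (s c : R) j i : 0 <= s ^+ j.*2 * c ^+ i.*2.
  by rewrite -!muln2 !exprM mulr_ge0 // -?exprM muln2 exprn_even_ge0 // odd_double.
(* [u k] is the coefficient of [s ^+ k.1.*2 * c ^+ k.2.*2] in the integrand, after symmetrising in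
   [s] and truncating the cosh. *)
pose u (k : 'I_N * 'I_N) w : R :=
  g w * (((z w) ^+ 2) ^+ k.1 / (k.1.*2)`!%:R * (Q w ^+ k.2 / D k.2)).
have mu_ k : measurable_fun setT (u k).
  apply: measurable_funM => //; apply: measurable_funM; apply: measurable_funM => //.
    by apply: measurable_funX; exact: measurable_funX.
  exact: measurable_funX.
have u0 k w : 0 <= u k w.
  by have z2 := sqr_ge0 (z w); rewrite /u mulr_ge0 // mulr_ge0 // divr_ge0 // exprn_ge0.
have mF (s c : R) :
    measurable_fun setT (fun w => g w * expR (s * z w) * sphere_mgf p.+1 N (c ^+ 2 * Q w)).
  apply: measurable_funM; last by apply: measurable_sphere_mgf; exact: measurable_funM.
  by apply: measurable_funM => //; apply: measurableT_comp => //; exact: measurable_funM.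
have Q2 (c : R) w : 0 <= c ^+ 2 * Q w by rewrite mulr_ge0 ?sqr_ge0.
have hu (s c : R) : s ^+ 2 + c ^+ 2 = 1 ->
   (\sum_(k : 'I_N * 'I_N) ((s ^+ (k.1.*2) * c ^+ (k.2.*2))%:E * \int[mu]_w (u k w)%:E) <= K%:E)%E.
  move=> sc; rewrite -integral_lincomb_ge0 //.
  have sc' : (- s) ^+ 2 + c ^+ 2 = 1 by rewrite sqrrN.
  apply: (integral_le_average _ _ _ _ _ _ _ _ (mF s c) (mF (- s) c)
    _ _ _ _ _ (hK s c sc) (hK (- s) c sc')).
  - by apply: measurable_sum => k; exact: measurable_funM.
  - by move=> w; rewrite !mulr_ge0 ?expR_ge0 ?sphere_mgf_ge0.
  - by move=> w; rewrite !mulr_ge0 ?expR_ge0 ?sphere_mgf_ge0.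
  - by move=> w; apply: sumr_ge0 => k _; rewrite mulr_ge0.
  - move=> w; rewrite mulNr.
    rewrite [leRHS](_ : _ = g w * sphere_mgf p.+1 N (c ^+ 2 * Q w) *
      (expR (s * z w) + expR (- (s * z w)))); last by ring.
    rewrite [leLHS](_ : _ = g w * sphere_mgf p.+1 N (c ^+ 2 * Q w) *
      ((\sum_(0 <= j < N) (s * z w) ^+ j.*2 / (j.*2)`!%:R) * 2)).
      by apply: ler_wpM2l; rewrite ?sum_even_le_cosh // mulr_ge0 ?sphere_mgf_ge0.
    rewrite [RHS]mulrA; congr (_ * _); rewrite /sphere_mgf !big_mkord -mulrA.
    rewrite [X in _ = _ * X]mulrC big_distrlr /= pair_bigA mulr_sumr.
    apply: eq_bigr => k _; rewrite /u /D /= -!mul2n !exprM !exprMn.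
    ring.
(* Any angle with nonzero sine and cosine shows that the mixed moments are finite. *)
have ufin k : (\int[mu]_w (u k w)%:E)%E \is a fin_num.
  have i0 j : (0 <= \int[mu]_w (u j w)%:E)%E.
    by apply: integral_ge0 => w _; rewrite lee_fin.
  rewrite ge0_fin_numE // ltey; apply/eqP => E.
  have /hu : (3 / 5) ^+ 2 + (4 / 5) ^+ 2 = 1 :> R by field.
  rewrite (bigD1 k) //= E gt0_muley ?lte_fin ?mulr_gt0 ?exprn_gt0 //.
  rewrite addye ?leye_eq // gt_eqF // (lt_le_trans ltNy0) //.
  by apply: sume_ge0 => j _; rewrite mule_ge0 ?lee_fin.
have [t ht] := beta_mean_value R p _ (index_enum ('I_N * 'I_N)%type)
  (fun k => fine (\int[mu]_w (u k w)%:E)%E) (fun k => k.1) (fun k => k.2).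
have := hu (sin t) (cos t); rewrite addrC cos2Dsin2 => /(_ erefl).
apply: le_trans.
apply: (@le_trans _ _ (\sum_(k : 'I_N * 'I_N) ((beta_moment p k.1 k.2)%:E * \int[mu]_w (u k w)%:E))%E).
  have b0 j i : 0 <= beta_moment p j i :> R.
    by rewrite /beta_moment !(mulr_ge0, invr_ge0) // (r0 0%N).
  rewrite -integral_lincomb_ge0 //; apply: integral_mono_ge0.
  - apply: measurable_funM => //; apply: measurable_sphere_mgf.
    by apply: measurable_funD => //; exact: measurable_funX.
  - by apply: measurable_sum => k; exact: measurable_funM.
  - by move=> w; rewrite mulr_ge0 // sphere_mgf_ge0 // addr_ge0 ?sqr_ge0.
  - move=> w; apply: le_trans (ler_wpM2l (g0 w) (sphere_mgfS_le _ _ _ _ _ (sqr_ge0 _) (Q0 w))) _.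
    rewrite big_mkord; under eq_bigr do rewrite big_mkord.
    rewrite pair_bigA mulr_sumr /= le_eqVlt; apply/orP; left; apply/eqP.
    by apply: eq_bigr => k _; rewrite /u /D mulrCA.
under eq_bigr do rewrite -(fineK (ufin _)) -EFinM mulrC.
under [leRHS]eq_bigr do rewrite -(fineK (ufin _)) -EFinM mulrC.
by rewrite !sumEFin lee_fin ht.
Qed.

(** Induction on the dimension, peeling off the first coordinate of [y = (s, c * y')]:
    [expR (s * Z ord0 w)] is absorbed into the weight [g] and [c] into the other [Z i]. This is why
    [g] is kept general. *)
Lemma sphere_average_le d (T : measurableType d) (R : realType)
    (mu : {measure set T -> \bar R}) (n N : nat) (g : T -> R)
    (Z : 'I_n.+1 -> T -> R) (K : R) :
  measurable_fun setT g -> (forall i, measurable_fun setT (Z i)) ->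
  (forall w, 0 <= g w) ->
  (forall y : 'I_n.+1 -> R, \sum_i y i ^+ 2 = 1 ->
    (\int[mu]_w (g w * expR (\sum_i Z i w * y i))%:E <= K%:E)%E) ->
  (\int[mu]_w (g w * sphere_mgf n.+1 N (\sum_i Z i w ^+ 2))%:E <= K%:E)%E.
Proof.
elim: n g Z => [|n IH] g Z mg mZ g0 hK.
  have mE (c : R) : measurable_fun setT (fun w => g w * expR (\sum_i Z i w * c)).
    apply: measurable_funM => //; apply: measurableT_comp => //.
    by apply: measurable_sum => i; exact: measurable_funM.
  have Q0 w : 0 <= \sum_i Z i w ^+ 2 by apply: sumr_ge0 => i _; exact: sqr_ge0.
  have s1 (c : R) : c ^+ 2 = 1 -> \sum_(i < 1) c ^+ 2 = 1 by rewrite big_ord1.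
  (* The unit sphere of R^1 is the pair [1], [-1], so the average is again a cosh. *)
  apply: (integral_le_average _ _ _ _ _ _ _ _ (mE 1) (mE (-1))
    _ _ _ _ _ (hK _ (s1 _ _)) (hK _ (s1 _ _))).
  - apply: measurable_funM => //; apply: measurable_sphere_mgf.
    by apply: measurable_sum => i; exact: measurable_funX.
  - by move=> w; rewrite mulr_ge0 ?expR_ge0.
  - by move=> w; rewrite mulr_ge0 ?expR_ge0.
  - by move=> w; rewrite mulr_ge0 ?sphere_mgf_ge0.
  - move=> w; rewrite !big_ord1 mulr1 mulrN1 -mulrA -mulrDr ler_wpM2l //.
    apply: le_trans (sum_even_le_cosh _ _ N).
    rewrite le_eqVlt; apply/orP; left; apply/eqP; congr (_ * _).
    by apply: eq_bigr => k _; rewrite fact_double -mul2n -exprM.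
  - by rewrite expr1n.
  - by rewrite sqrrN expr1n.
under eq_integral do rewrite big_ord_recl.
apply: sphere_average_step => //.
- by apply: measurable_sum => i; exact: measurable_funX.
- by move=> w; apply: sumr_ge0 => i _; exact: sqr_ge0.
move=> s c sc.
have E w : c ^+ 2 * (\sum_(i < n.+1) Z (lift ord0 i) w ^+ 2) =
    \sum_(i < n.+1) (c * Z (lift ord0 i) w) ^+ 2.
  by rewrite mulr_sumr; apply: eq_bigr => i _; rewrite exprMn.
under eq_integral do rewrite E.
apply: (IH (fun w => g w * expR (s * Z ord0 w)) (fun i w => c * Z (lift ord0 i) w)).
- apply: measurable_funM => //; apply: measurableT_comp => //.
  exact: measurable_funM.
- by move=> i; exact: measurable_funM.
- by move=> w; rewrite mulr_ge0 ?expR_ge0.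
move=> y y1.
pose y' i := if unlift ord0 i is Some j then c * y j else s.
have y'1 : \sum_i y' i ^+ 2 = 1.
  rewrite big_ord_recl {1}/y' unlift_none.
  under eq_bigr do rewrite /y' liftK exprMn.
  by rewrite -mulr_sumr y1 mulr1.
apply: le_trans (hK _ y'1); rewrite le_eqVlt; apply/orP; left; apply/eqP.
apply: eq_integral => w _; congr _%:E.
rewrite [in RHS]big_ord_recl {1}/y' unlift_none expRD mulrA [Z ord0 w * s]mulrC; congr (_ * expR _).
by apply: eq_bigr => i _; rewrite /y' liftK; ring.
Qed.

(* Cauchy-Schwarz between the terms of [sphere_mgf] and those of
   [(1 - e ^+ 2) `^ (- n / 2)], whose products are squares of terms of [expR (e * r / 2)]. *)
Lemma sqr_sum_exp_le (R : rcfType) n N (e r : R) : 0 < e < 1 ->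
  (\sum_(0 <= k < N) (e * r / 2) ^+ k / k`!%:R) ^+ 2 <=
  Num.sqrt (((1 - e ^+ 2) ^+ n.+1)^-1) * sphere_mgf n.+1 N (r ^+ 2).
Proof.
move=> /andP[e0 e1].
have e2 : 0 <= e ^+ 2 < 1 by rewrite sqr_ge0 /= expr_lt1 // ltW.
rewrite [leRHS]mulrC; apply: le_trans (ler_wpM2l (sphere_mgf_ge0 _ _ _ _ (sqr_ge0 r))
  (sum_rfact_half_le _ _ n.+1 N _ e2)) => //.
have f0 k : 0 < k`!%:R :> R by rewrite ltr0n fact_gt0.
have r0 k : 0 < rfact (n.+1%:R / 2) k :> R by rewrite rfact_gt0 // divr_gt0.
have p0 k : 0 < 4 ^+ k :> R by rewrite exprn_gt0.
apply: sum_sqr_le_mul => k.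
- apply: divr_ge0; first by rewrite -exprM mulnC exprM sqr_ge0.
  by rewrite ltW // !mulr_gt0.
- apply: mulr_ge0; first by rewrite divr_ge0 // ltW.
  by rewrite -exprM mulnC exprM sqr_ge0.
rewrite le_eqVlt; apply/orP; left; apply/eqP.
rewrite (_ : 4 ^+ k = (2 ^+ k) ^+ 2); last by rewrite exprAC; congr (_ ^+ _); ring.
rewrite (exprAC r) (exprAC e) !exprMn exprVn.
by field; rewrite !gt_eqF // exprn_gt0.
Qed.

Lemma measurable_fun_sqrt d (T : measurableType d) (R : realType) (f : T -> R) :
  measurable_fun setT f -> measurable_fun setT (fun w => Num.sqrt (f w)).
Proof.
move=> mf; apply: measurableT_comp mf; apply: continuous_measurable_fun.
exact: sqrt_continuous.
Qed.

(** Monotone convergence in the truncation [N]. Since [sqr_sum_exp_le] bounds a square,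
    [expR (e * r)] is approached by squares of partial sums of [expR (e * r / 2)]. *)
Lemma integral_exp_norm_le d (T : measurableType d) (R : realType)
    (mu : {measure set T -> \bar R}) (n : nat) (g : T -> R)
    (Z : 'I_n.+1 -> T -> R) (K e : R) :
  measurable_fun setT g -> (forall i, measurable_fun setT (Z i)) ->
  (forall w, 0 <= g w) -> 0 < e < 1 ->
  (forall y : 'I_n.+1 -> R, \sum_i y i ^+ 2 = 1 ->
    (\int[mu]_w (g w * expR (\sum_i Z i w * y i))%:E <= K%:E)%E) ->
  (\int[mu]_w (g w * expR (e * Num.sqrt (\sum_i Z i w ^+ 2)))%:E <=
    (Num.sqrt (((1 - e ^+ 2) ^+ n.+1)^-1) * K)%:E)%E.
Proof.
move=> mg mZ g0 e01 hK.
pose Q w := \sum_i Z i w ^+ 2.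
have Q0 w : 0 <= Q w by apply: sumr_ge0 => i _; exact: sqr_ge0.
have mQ : measurable_fun setT Q by apply: measurable_sum => i; exact: measurable_funX.
pose a w := e * Num.sqrt (Q w) / 2.
have a0 w : 0 <= a w by rewrite divr_ge0 // mulr_ge0 ?sqrtr_ge0 //; case/andP: e01 => /ltW.
pose f N w := g w * (series (exp_coeff (a w)) N) ^+ 2.
have s0 N w : 0 <= series (exp_coeff (a w)) N.
  by apply: sumr_ge0 => k _; exact: exp_coeff_ge0.
have f0 N w : 0 <= f N w by rewrite mulr_ge0 ?sqr_ge0.
have mf N : measurable_fun setT (f N).
  apply: measurable_funM => //; apply: measurable_funX; apply: measurable_sum => k.
  apply: measurable_funM => //; apply: measurable_funX.
  do 2! apply: measurable_funM => //.
  exact: measurable_fun_sqrt.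
have fS i j w : (i <= j)%N -> f i w <= f j w.
  move=> ij; rewrite ler_wpM2l // ler_sqr ?nnegrE // /series /=.
  rewrite [leRHS](big_cat_nat _ ij) //= lerDl sumr_ge0 // => k _.
  exact: exp_coeff_ge0.
have -> : (\int[mu]_w (g w * expR (e * Num.sqrt (Q w)))%:E =
   \int[mu]_w limn (fun N => (f N w)%:E))%E.
  apply: eq_integral => w _; apply/esym/cvg_lim => //.
  apply: cvg_EFin; first by exact: nearW.
  rewrite (_ : e * _ = a w + a w); last by rewrite /a; field.
  rewrite expRD /f; apply: cvgM; first exact: cvg_cst.
  under eq_fun do rewrite expr2.
  by apply: cvgM; exact: is_cvg_series_exp_coeff.
rewrite (monotone_convergence mu) //; first last.
- by move=> w _ i j ij; rewrite lee_fin fS.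
- by move=> N w _; rewrite lee_fin.
- by move=> N; exact/measurable_EFinP.
apply: lime_le.
  apply: ereal_nondecreasing_is_cvgn => i j ij.
  by apply: integral_mono_ge0 => // w; exact: fS.
apply: nearW => N.
have c0 : 0 <= Num.sqrt (((1 - e ^+ 2) ^+ n.+1)^-1) by exact: sqrtr_ge0.
have mG : measurable_fun setT (fun w => g w * sphere_mgf n.+1 N (Q w)).
  by apply: measurable_funM => //; exact: measurable_sphere_mgf.
have G0 w : 0 <= g w * sphere_mgf n.+1 N (Q w) by rewrite mulr_ge0 ?sphere_mgf_ge0.
rewrite EFinM; apply: le_trans (lee_wpmul2l _
  (sphere_average_le _ _ _ mu n N g Z K mg mZ g0 hK)); last by rewrite lee_fin.
rewrite -ge0_integralZl_EFin //.
- under [leRHS]eq_integral do rewrite -EFinM.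
  apply: integral_mono_ge0 => //; first exact: measurable_funM.
  move=> w; rewrite mulrCA ler_wpM2l //.
  by have := sqr_sum_exp_le _ n N e (Num.sqrt (Q w)) e01; rewrite sqr_sqrtr.
- by move=> w _; rewrite lee_fin.
- exact/measurable_EFinP.
Qed.

(** * Measurability of the operator norm *)

Lemma vnorm_ge0 (R : realType) k (x : 'cV[R]_k) : 0 <= vnorm x.
Proof. exact: sqrtr_ge0. Qed.

Lemma sqr_vnorm (R : realType) k (x : 'cV[R]_k) : vnorm x ^+ 2 = \sum_i x i 0 ^+ 2.
Proof. by rewrite sqr_sqrtr // sumr_ge0 // => i _; exact: sqr_ge0. Qed.

Lemma vnormZ (R : realType) k (a : R) (x : 'cV[R]_k) : vnorm (a *: x) = `|a| * vnorm x.
Proof.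
rewrite -sqrtr_sqr -sqrtrM ?sqr_ge0 // mulr_sumr; congr (Num.sqrt _).
by apply: eq_bigr => i _; rewrite mxE exprMn.
Qed.

Lemma vnorm0 (R : realType) k : vnorm (0 : 'cV[R]_k) = 0.
Proof. by rewrite -(scale0r 0) vnormZ normr0 mul0r. Qed.

Lemma dot_le_norm (R : realType) (I : finType) (x y : I -> R) :
  \sum_i x i * y i <= Num.sqrt (\sum_i x i ^+ 2) * Num.sqrt (\sum_i y i ^+ 2).
Proof.
have S0 (z : I -> R) : 0 <= \sum_i z i ^+ 2 by apply: sumr_ge0 => i _; exact: sqr_ge0.
rewrite -sqrtrM //; apply: le_trans (ler_norm _) _.
rewrite -sqrtr_sqr ler_wsqrtr // sum_sqr_le_mul // => i; rewrite ?sqr_ge0 //.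
by rewrite exprMn.
Qed.

(** The square of the Frobenius norm; it yields the crude bound that makes the supremum in [opnorm]
    finite. *)
Definition frobenius {R : realType} {m n} (A : 'M[R]_(m, n)) : R :=
  \sum_i \sum_j A i j ^+ 2.

Lemma vnorm_mulmx_le (R : realType) m n (A : 'M[R]_(m, n)) (x : 'cV[R]_n) :
  vnorm (A *m x) <= Num.sqrt (frobenius A) * vnorm x.
Proof.
have S0 k (z : 'I_k -> R) : 0 <= \sum_i z i ^+ 2 by apply: sumr_ge0 => i _; exact: sqr_ge0.
have f0 : 0 <= frobenius A by apply: sumr_ge0 => i _; exact: S0.
rewrite /vnorm -sqrtrM // ler_wsqrtr // mulr_suml; apply: ler_sum => i _.
rewrite mxE sum_sqr_le_mul // => j; rewrite ?sqr_ge0 //.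
by rewrite exprMn.
Qed.

Lemma vnorm_mulmx_le_opnorm (R : realType) m n (A : 'M[R]_(m, n)) (x : 'cV[R]_n) :
  vnorm x = 1 -> vnorm (A *m x) <= opnorm A.
Proof.
move=> x1; apply: sup_upper_bound; last by exists x.
split; first by exists (vnorm (A *m x)), x.
exists (Num.sqrt (frobenius A)) => _ [y y1 <-].
by have := vnorm_mulmx_le _ _ _ A y; rewrite y1 mulr1.
Qed.

(** For [n = 0] the sphere is empty and [sup] takes the value [0], which is where [0 <= t]
    enters. *)
Lemma opnorm_le (R : realType) m n (A : 'M[R]_(m, n)) (t : R) : 0 <= t ->
  (forall x, vnorm x = 1 -> vnorm (A *m x) <= t) -> opnorm A <= t.
Proof.
move=> t0 h; rewrite /opnorm; have [->|/set0P ne] := eqVneq [set vnorm (A *m x) | x in @sphere R n] set0.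
  by rewrite sup0.
by apply: ge_sup => // _ [x x1 <-]; exact: h.
Qed.

(** A countable dense family of directions. Indices that code no vector give [0], and so does the
    zero vector, since [0^-1 = 0]. *)
Definition rat_direction {R : realType} {n} (k : nat) : 'cV[R]_n :=
  if unpickle k is Some q then
    let x : 'cV[R]_n := map_mx ratr (q : 'cV[rat]_n) in (vnorm x)^-1 *: x
  else 0.

Lemma vnorm_rat_direction (R : realType) n k :
  rat_direction k = 0 :> 'cV[R]_n \/ vnorm (rat_direction k : 'cV[R]_n) = 1.
Proof.
rewrite /rat_direction; case: unpickle => [q|]; last by left.
set x : 'cV[R]_n := map_mx _ _ => /=.
have [x0|x0] := eqVneq (vnorm x) 0; first by left; rewrite x0 invr0 scale0r.
by right; rewrite vnormZ normfV ger0_norm ?vnorm_ge0 // mulVf.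
Qed.

Lemma cvg_finsum (R : realType) (I : Type) (s : seq I) (f : I -> nat -> R) (l : I -> R) :
  (forall i, f i k @[k --> \oo] --> l i) ->
  (\sum_(i <- s) f i k) @[k --> \oo] --> \sum_(i <- s) l i.
Proof.
move=> h; elim: s => [|i s IH].
  by under eq_fun do rewrite big_nil; rewrite big_nil; exact: cvg_cst.
under eq_fun do rewrite big_cons; rewrite big_cons; exact: cvgD.
Qed.

(** Homogeneity extends the bound to all rational vectors, and density extends it to the sphere.
    This reduces the supremum to countably many measurable functions. *)
Lemma opnorm_le_rat (R : realType) m n (A : 'M[R]_(m, n)) (t : R) : 0 <= t ->
  (forall k, vnorm (A *m rat_direction k) <= t) -> opnorm A <= t.
Proof.
move=> t0 h.
have hq (q : 'cV[rat]_n) : vnorm (A *m map_mx ratr q) <= t * vnorm (map_mx ratr q : 'cV[R]_n).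
  have := h (pickle q); rewrite /rat_direction pickleK /=.
  set x : 'cV[R]_n := map_mx _ _.
  rewrite -scalemxAr vnormZ normfV ger0_norm ?vnorm_ge0 //.
  have [x0 _|x0] := eqVneq (vnorm x) 0.
    by apply: le_trans (vnorm_mulmx_le _ _ _ _ _) _; rewrite x0 !mulr0.
  by rewrite ler_pdivrMl 1?mulrC // lt_neqAle eq_sym x0 vnorm_ge0.
apply: opnorm_le => // v v1.
have app (k : nat) j : exists q : rat, v j 0 - k.+1%:R^-1 < ratr q < v j 0 + k.+1%:R^-1.
  have : v j 0 - k.+1%:R^-1 < v j 0 + k.+1%:R^-1.
    have : 0 < k.+1%:R^-1 :> R by rewrite invr_gt0.
    by move: (k.+1%:R^-1) => z; lra.
  by move=> /rat_in_itvoo[q]; rewrite in_itv /= => hq'; exists q.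
pose qs k : 'cV[rat]_n := \col_j sval (cid (app k j)).
pose x k : 'cV[R]_n := map_mx ratr (qs k).
have cx j : x k j 0 @[k --> \oo] --> v j 0.
  have c1 (c : R) : c + k.+1%:R^-1 @[k --> \oo] --> c.
    by rewrite -[X in _ --> X]addr0; apply: cvgD; [exact: cvg_cst|exact: cvg_harmonic].
  have c2 (c : R) : c - k.+1%:R^-1 @[k --> \oo] --> c.
    by rewrite -[X in _ --> X]subr0; apply: cvgB; [exact: cvg_cst|exact: cvg_harmonic].
  apply: (squeeze_cvgr _ (c2 _) (c1 _)); apply: nearW => k.
  rewrite /x !mxE; case: (cid (app k j)) => q /= /andP[a b].
  by rewrite !ltW.
(* Squared norms are polynomial in the entries, so sums and products of limits suffice. *)
have cN k' (y : nat -> 'cV[R]_k') (z : 'cV[R]_k') : (forall j, y k j 0 @[k --> \oo] --> z j 0) ->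
    vnorm (y k) ^+ 2 @[k --> \oo] --> vnorm z ^+ 2.
  move=> c; under eq_fun do rewrite sqr_vnorm; rewrite sqr_vnorm.
  apply: cvg_finsum => j; rewrite expr2; under eq_fun do rewrite expr2.
  exact: cvgM.
have cA : vnorm (A *m x k) ^+ 2 @[k --> \oo] --> vnorm (A *m v) ^+ 2.
  apply: cN => i; rewrite mxE; under eq_fun do rewrite mxE.
  by apply: cvg_finsum => j; apply: cvgM; [exact: cvg_cst|].
have cv : t ^+ 2 * vnorm (x k) ^+ 2 @[k --> \oo] --> t ^+ 2 * vnorm v ^+ 2.
  by apply: cvgM; [exact: cvg_cst|exact: cN].
rewrite -ler_sqr ?nnegrE ?vnorm_ge0 //.
rewrite -[t ^+ 2]mulr1 -[1](expr1n _ 2) -v1.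
apply: (ler_cvg_to cA cv); apply: nearW => k.
rewrite -exprMn ler_sqr ?nnegrE ?mulr_ge0 ?vnorm_ge0 //; exact: hq.
Qed.

Lemma measurable_vnorm d (T : measurableType d) (R : realType) k (x : T -> 'cV[R]_k) :
  (forall i, measurable_fun setT (fun w => x w i 0)) ->
  measurable_fun setT (fun w => vnorm (x w)).
Proof.
move=> mx; apply: measurable_fun_sqrt.
by apply: measurable_sum => i; exact: measurable_funX.
Qed.

Lemma measurable_mulmx d (T : measurableType d) (R : realType) m n p
    (A : T -> 'M[R]_(m, n)) (B : T -> 'M[R]_(n, p)) i k :
  (forall i j, measurable_fun setT (fun w => A w i j)) ->
  (forall j k, measurable_fun setT (fun w => B w j k)) ->
  measurable_fun setT (fun w => (A w *m B w) i k).
Proof.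
move=> mA mB; under eq_fun do rewrite mxE.
by apply: measurable_sum => j; exact: measurable_funM.
Qed.

(** * The tail bound *)

(* [v] plays the role of a measurable selection of nearly maximising directions. *)
Lemma selected_tail_le d (T : measurableType d) (R : realType)
    (mu : {measure set T -> \bar R}) m n (A : T -> 'M[R]_(m.+1, n.+1))
    (v : T -> 'cV[R]_n.+1) (E : set T) (t K lam e : R) :
  (forall i j, measurable_fun setT (fun w => A w i j)) ->
  (forall x y, vnorm x = 1 -> vnorm y = 1 ->
    (\int[mu]_w (expR (lam * bilin x (A w) y))%:E <= K%:E)%E) ->
  measurable E -> (forall j, measurable_fun setT (fun w => v w j 0)) ->
  (forall w, vnorm (v w) <= 1) -> (forall w, E w -> t <= vnorm (A w *m v w)) ->
  0 < lam -> 0 < e < 1 ->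
  ((expR (e ^+ 2 * lam * t))%:E * mu E <=
   (Num.sqrt (((1 - e ^+ 2) ^+ m.+1)^-1) *
    (Num.sqrt (((1 - e ^+ 2) ^+ n.+1)^-1) * K))%:E)%E.
Proof.
move=> mA hK mE mv v1 vt lam0 e01; have /andP[e0 e1] := e01.
have vnorm_col k (x : 'I_k -> R) : \sum_i x i ^+ 2 = 1 -> vnorm (\col_i x i) = 1.
  by move=> x1; rewrite /vnorm; under eq_bigr do rewrite mxE; rewrite x1 sqrtr1.
have bilinE (x : 'I_m.+1 -> R) (y : 'cV[R]_n.+1) w :
    lam * bilin (\col_i x i) (A w) y = \sum_j (lam * \sum_i x i * A w i j) * y j 0.
  rewrite /bilin mxE mulr_sumr; apply: eq_bigr => j _.
  rewrite mulrA mxE; congr (_ * _ * _).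
  by apply: eq_bigr => i _; rewrite !mxE.
have mZ (x : 'I_m.+1 -> R) j : measurable_fun setT (fun w => lam * \sum_i x i * A w i j).
  by apply: measurable_funM => //; apply: measurable_sum => i; exact: measurable_funM.
have mexp (h : T -> R) : measurable_fun setT h -> measurable_fun setT (fun w => expR (h w)).
  by move=> mh; apply: measurableT_comp.
(* First averaging, over the right direction [y], with the left direction [x] fixed. *)
have step1 (x : 'I_m.+1 -> R) : \sum_i x i ^+ 2 = 1 ->
    (\int[mu]_w (1 * expR (e * Num.sqrt (\sum_j (lam * \sum_i x i * A w i j) ^+ 2)))%:E <=
     (Num.sqrt (((1 - e ^+ 2) ^+ n.+1)^-1) * K)%:E)%E.
  move=> x1; apply: (integral_exp_norm_le _ _ _ mu n (fun=> 1)
    (fun j w => lam * \sum_i x i * A w i j)) => //.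
  move=> y y1; apply: le_trans (hK _ _ (vnorm_col _ _ x1) (vnorm_col _ _ y1)).
  rewrite le_eqVlt; apply/orP; left; apply/eqP; apply: eq_integral => w _.
  rewrite bilinE mul1r; congr (expR _)%:E.
  by apply: eq_bigr => j _; rewrite [in RHS]mxE.
pose Z i w := e * lam * (A w *m v w) i 0.
have mZ2 i : measurable_fun setT (Z i).
  apply: measurable_funM => //; apply: measurable_mulmx => // j k.
  by rewrite (ord1 k).
have mI : measurable_fun setT (\1_E : T -> R) by exact: measurable_indic.
have I0 w : 0 <= \1_E w :> R by rewrite indicE.
(* Second averaging, over the left direction, with the indicator of [E] as weight. *)
have := integral_exp_norm_le _ _ _ mu m (\1_E) Z
  (Num.sqrt (((1 - e ^+ 2) ^+ n.+1)^-1) * K) e mI mZ2 I0 e01.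
move=> step2; apply: le_trans (step2 _); last first.
  move=> x x1; apply: le_trans (step1 x x1); apply: integral_mono_ge0.
  - apply: measurable_funM => //; apply: mexp.
    by apply: measurable_sum => i; exact: measurable_funM.
  - apply: measurable_funM => //; apply: mexp; apply: measurable_funM => //.
    apply: measurable_fun_sqrt.
    by apply: measurable_sum => i; exact: measurable_funX.
  - by move=> w; rewrite mulr_ge0 ?expR_ge0.
  (* Cauchy-Schwarz with [|v| <= 1] bounds the exponent by [e * |lam A^T x|], so the random [v]
     disappears and [step1] applies. *)
  - move=> w; apply: ler_pM; rewrite ?expR_ge0 //.
    rewrite ler_expR.
    have -> : \sum_i Z i w * x i = e * \sum_j (lam * \sum_i x i * A w i j) * v w j 0.
      rewrite -bilinE /bilin -mulmxA mxE !mulr_sumr; apply: eq_bigr => i _.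
      by rewrite /Z !mxE; ring.
    rewrite ler_wpM2l ?(ltW e0) //.
    apply: le_trans (dot_le_norm _ _ _ _) _.
    by rewrite -[leRHS]mulr1 ler_wpM2l ?sqrtr_ge0 //; exact: v1.
(* Markov's inequality: on [E] the vector [Z] has norm at least [e * lam * t]. *)
rewrite -[E in mu E]setIT -integral_indic // -ge0_integralZl_EFin ?expR_ge0 //.
- under eq_integral do rewrite -EFinM.
  apply: integral_mono_ge0.
  - exact: measurable_funM.
  - apply: measurable_funM => //; apply: mexp; apply: measurable_funM => //.
    apply: measurable_fun_sqrt.
    by apply: measurable_sum => i; exact: measurable_funX.
  - by move=> w; rewrite mulr_ge0 ?expR_ge0.
  - move=> w; rewrite mulrC indicE; case: (boolP (w \in E)) => [|_]; last by rewrite !mul0r.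
    rewrite inE => Ew; rewrite !mul1r ler_expR.
    have -> : \sum_i Z i w ^+ 2 = vnorm ((e * lam) *: (A w *m v w)) ^+ 2.
      by rewrite sqr_vnorm; apply: eq_bigr => i _; rewrite [in RHS]mxE.
    rewrite sqrtr_sqr ger0_norm ?vnorm_ge0 // vnormZ ger0_norm; last by rewrite mulr_ge0 // ltW.
    rewrite expr2 -!mulrA ler_wpM2l ?(ltW e0) // mulrA mulrA -mulrA.
    by rewrite mulrA ler_wpM2l ?vt // mulr_ge0 // ltW.
by apply/measurable_EFinP.
Qed.

(** The event [opnorm > t] is the countable union of the [F k]. On a finite union a direction
    witnessing it can be selected measurably; continuity from below then gives the whole event. *)
Lemma opnorm_tail_le d (T : measurableType d) (R : realType)
    (mu : {measure set T -> \bar R}) m n (A : T -> 'M[R]_(m.+1, n.+1)) (t K lam e : R) :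
  (forall i j, measurable_fun setT (fun w => A w i j)) ->
  (forall x y, vnorm x = 1 -> vnorm y = 1 ->
    (\int[mu]_w (expR (lam * bilin x (A w) y))%:E <= K%:E)%E) ->
  0 <= t -> 0 < lam -> 0 < e < 1 ->
  measurable [set w | opnorm (A w) <= t] /\
  ((expR (e ^+ 2 * lam * t))%:E * mu (~` [set w | (opnorm (A w) <= t)%R]) <=
   (Num.sqrt (((1 - e ^+ 2) ^+ m.+1)^-1) *
    (Num.sqrt (((1 - e ^+ 2) ^+ n.+1)^-1) * K))%:E)%E.
Proof.
move=> mA hK t0 lam0 e01.
pose F k := [set w | t < vnorm (A w *m rat_direction k)].
have mN (x : T -> 'cV[R]_n.+1) : (forall j, measurable_fun setT (fun w => x w j 0)) ->
    measurable_fun setT (fun w => vnorm (A w *m x w)).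
  move=> mx; apply: measurable_vnorm => i; apply: measurable_mulmx => // j k.
  by rewrite (ord1 k).
have mb k : measurable_fun setT (fun w => t < vnorm (A w *m rat_direction k)).
  by apply: measurable_fun_ltr => //; exact: mN.
have mF k : measurable (F k).
  by rewrite -[F k]setTI; exact: (mb k measurableT [set true]).
have UF : ~` [set w | opnorm (A w) <= t] = \bigcup_k F k.
  apply/seteqP; split => w /=.
    move=> h; apply: contrapT => nF; apply: h; apply: opnorm_le_rat => // k.
    by rewrite leNgt; apply/negP => Fk; apply: nF; exists k.
  move=> [k _ /= Fk] ot; move: Fk; apply/negP; rewrite -leNgt.
  case: (vnorm_rat_direction R n.+1 k) => [->|x1]; first by rewrite mulmx0 vnorm0.
  exact: le_trans (vnorm_mulmx_le_opnorm _ _ _ _ _ x1) ot.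
pose E N := \big[setU/set0]_(k < N) F k.
have mE N : measurable (E N) by apply: bigsetU_measurable.
(* Selects the largest index below [N] whose direction exceeds [t], and [0] if there is none. *)
pose v := fix v N w : 'cV[R]_n.+1 :=
  if N is N'.+1 then if t < vnorm (A w *m rat_direction N') then rat_direction N' else v N' w
  else 0.
have mv N j : measurable_fun setT (fun w => v N w j 0).
  elim: N => [|N IH]; first exact: measurable_cst.
  rewrite (_ : (fun w => _) = fun w => if t < vnorm (A w *m rat_direction N)
    then (rat_direction N : 'cV[R]_n.+1) j 0 else v N w j 0).
    by apply: measurable_fun_ifT.
  by apply/funext => w /=; case: ifP.
have v1 N w : vnorm (v N w) <= 1.
  elim: N => [|N IH] /=; first by rewrite vnorm0.
  by case: ifP => // _; case: (vnorm_rat_direction R n.+1 N) => ->; rewrite ?vnorm0.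
have vt N w : E N w -> t <= vnorm (A w *m v N w).
  elim: N => [|N IH]; first by rewrite /E big_ord0.
  rewrite /E big_ord_recr /= => h; case: ifP => [/ltW //|tN].
  by case: h => [/IH //|]; rewrite /F /= tN.
have hE N := selected_tail_le _ _ _ mu m n A (v N) (E N) t K lam e
  mA hK (mE N) (mv N) (v1 N) (vt N) lam0 e01.
split.
  by rewrite -[X in measurable X]setCK UF; apply: measurableC; exact: bigcup_measurable.
rewrite UF -bigcup_bigsetU_bigcup.
have mU N : measurable (\big[setU/set0]_(k < N.+1) F k) by exact: bigsetU_measurable.
have cE : mu (E N.+1) @[N --> \oo] --> mu (\bigcup_N \big[setU/set0]_(k < N.+1) F k).
  apply: nondecreasing_cvg_mu => //; first exact: bigcup_measurable.
  by move=> i j ij; apply/subsetPset; apply: subset_bigsetU.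
have cM := cvgeZl (fin_numE (expR (e ^+ 2 * lam * t))%:E) cE.
rewrite -(cvg_lim _ cM) //; apply: lime_le; first by apply/cvg_ex; eexists; exact: cM.
exact: nearW.
Qed.

Lemma sqrt_invX_expR (R : realType) (x : R) n : 0 < x ->
  Num.sqrt ((x ^+ n)^-1) = expR (n%:R / 2 * ln (1 / x)).
Proof.
move=> x0.
apply/eqP; rewrite -(eqrXn2 (n := 2)) ?sqrtr_ge0 ?expR_ge0 // sqr_sqrtr; last first.
  by rewrite invr_ge0 exprn_ge0 // ltW.
rewrite -expRM_natl.
rewrite (_ : _ * _ = n%:R * ln (1 / x)); last by field.
by rewrite expRM_natl lnK ?posrE ?div1r ?invr_gt0 // exprVn.
Qed.

Theorem theorem4 (d : measure_display) (T : measurableType d) (R : realType)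
  (P : probability T R) (m n : nat) (A : T -> 'M[R]_(m, n)) (sigma : R)
  (hsigma : 0 < sigma) (hA : subgaussian_matrix P A sigma)
  (delta eps : R) (hdelta : 0 < delta < 1) (heps : 0 < eps < 1) :
  ((1 - delta)%:E <=
   P [set w | (opnorm (A w) <=
      sigma * Num.sqrt (ln (1 / (1 - eps ^+ 2)) / eps ^+ 4 * (m + n)%:R
                        + 2 / eps ^+ 4 * ln (1 / delta)))%R])%E.
Proof.
have [mA [_ [_ hE]]] := hA.
have /andP[e0 e1] := heps; have /andP[d0 d1] := hdelta.
have e2 : 0 < 1 - eps ^+ 2 by rewrite subr_gt0 expr_lt1 // ltW.
set L := ln (1 / (1 - eps ^+ 2)); set D := ln (1 / delta).
set S := (X in Num.sqrt X); set t := sigma * _.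
have L0 : 0 <= L.
  by rewrite ln_ge0 // div1r invf_ge1 // gerBl sqr_ge0.
have D0 : 0 < D by rewrite ln_gt0 // div1r invf_gt1.
have S0 : 0 < S.
  apply: ltr_wpDl; last by rewrite mulr_gt0 // divr_gt0 // exprn_gt0.
  by apply: mulr_ge0 => //; rewrite divr_ge0 // exprn_ge0 // ltW.
have t0 : 0 < t by rewrite mulr_gt0 // sqrtr_gt0.
have triv : (forall w, opnorm (A w) <= t) ->
    ((1 - delta)%:E <= P [set w | (opnorm (A w) <= t)%R])%E.
  move=> h; rewrite (_ : [set w | _] = setT); last by apply/seteqP; split => w // _; exact: h.
  by rewrite probability_setT lee_fin gerBl ltW.
have tE : t = sigma * Num.sqrt S by [].
(* With [m = 0] or [n = 0] the bound holds surely; the averaging argument concerns positive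
   dimensions. *)
case: m n A hA mA hE @S t tE S0 t0 triv => [|m] [|n] A hA mA hE S t tE S0 t0 triv.
- by apply: triv => w; apply: opnorm_le (ltW t0) _ => x _; rewrite /vnorm big_ord0 sqrtr0 ltW.
- by apply: triv => w; apply: opnorm_le (ltW t0) _ => x _; rewrite /vnorm big_ord0 sqrtr0 ltW.
- apply: triv => w; apply: opnorm_le (ltW t0) _ => x.
  by rewrite /vnorm big_ord0 sqrtr0 => /eqP; rewrite eq_sym oner_eq0.
(* The minimiser of [lam^2 sigma^2 / 2 - eps^2 lam t]. *)
pose lam := eps ^+ 2 * t / sigma ^+ 2.
have lam0 : 0 < lam by rewrite divr_gt0 ?mulr_gt0 ?exprn_gt0.
have hK x y : vnorm x = 1 -> vnorm y = 1 ->
  (\int[P]_w (expR (lam * bilin x (A w) y))%:E <= (expR (lam ^+ 2 * sigma ^+ 2 / 2))%:E)%E.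
  move=> x1 y1; have := hE lam x y; rewrite unlock; apply; rewrite inE //.
have [mO] := opnorm_tail_le _ _ _ P m n A t _ lam eps mA hK (ltW t0) lam0 heps.
set B := [set w | _] in mO *.
rewrite [X in (_ * X)%E](_ : _ = (1 - P B)%E); last exact: probability_setC.
rewrite -(fineK (fin_num_measure P _ mO)) -EFinB -EFinM !lee_fin.
rewrite !sqrt_invX_expR // -/L -!expRD.
(* The radicand [S] is chosen so that [eps^4 S / 2 = L (m + n) / 2 + D]; cancelling [expR (eps^4 S)]
   leaves [expR (- D) = delta]. *)
rewrite [X in _ <= expR X](_ : _ = eps ^+ 2 * lam * t + - D); last first.
  have s2 : Num.sqrt S ^+ 2 = S by rewrite sqr_sqrtr // ltW.
  have -> : lam ^+ 2 * sigma ^+ 2 / 2 = eps ^+ 4 * S / 2.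
    rewrite -s2 /lam tE; field; rewrite gt_eqF //.
  have -> : eps ^+ 2 * lam * t = eps ^+ 4 * S.
    rewrite -s2 /lam tE; field; rewrite gt_eqF //.
  rewrite /S natrD; field; rewrite gt_eqF //.
rewrite expRD ler_pM2l ?expR_gt0 // expRN lnK ?posrE ?div1r ?invr_gt0 // invrK.
by rewrite lerBlDr addrC -lerBlDr.
Qed.
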